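(* Assume $\beta(x)=0$, i.e. $f(x)=h(x)^t$, and let $C$ be an ideal of $\mathcal{R}_2=\frac{GR(p^2,m)[x]}{\langle f(x)\rangle}$. Let $k,\ell,n<t$ be nonnegative integers with $n<k$, and let $\delta(x)\in GR(p^2,m)[x]$ satisfy $\delta(x)\notin\langle p,h(x)\rangle$ and $\deg\delta(x)<(k-\ell)\deg h(x)$. (1) If $C=\langle h(x)^k\rangle$, then $T_0(C)=k$ and $T_1(C)=k$. (2) If $C=\langle h(x)^k+ph(x)^\ell\delta(x)\rangle$, then $T_0(C)=k$ and $T_1(C)=\min(k,t-k+\ell)$. (3) If $C=\langle h(x)^k,\ ph(x)^n\rangle$, then $T_0(C)=k$ and $T_1(C)=\min(k,n)$. (4) If $C=\langle h(x)^k+ph(x)^\ell\delta(x),\ ph(x)^n\rangle$, then $T_0(C)=k$ and $T_1(C)=\min(k,t-k+\ell,n)$.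
   Context: $p$ is a prime, $m\ge 1$; $GR(p^2,m)$ is the Galois ring of characteristic $p^2$ with $p^{2m}$ elements, with maximal ideal $\langle p\rangle$ and residue field $\mathbb{F}_{p^m}$; $\mu$ (or a bar) denotes reduction modulo $p$. Standing assumption: $f(x)\in GR(p^2,m)[x]$ is a monic regular (not a zero divisor) primary (generating a primary ideal) polynomial, not a unit, of the form $f(x)=h(x)^t+p\beta(x)$ with $t\ge1$, $h(x)$ monic basic irreducible (irreducible with irreducible reduction modulo $p$), and $\beta(x)=0$ or $\deg\beta(x)<t\deg h(x)$. Torsional degrees: for an ideal $C$ of $\mathcal{R}_2$ and $i\in\{0,1\}$, $\mathrm{Tor}_i(C)=\{\mu(v): v\in\mathcal{R}_2,\ p^iv\in C\}$ is an ideal of $\mathbb{F}_{p^m}[x]/\langle\overline f(x)\rangle=\mathbb{F}_{p^m}[x]/\langle\overline h(x)^t\rangle$, hence equals $\langle \overline h(x)^{T_i}\rangle$ for a unique $0\le T_i\le t$; $T_i(C):=T_i$. *)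

(* Defs.v *)
From HB Require Import structures.
From mathcomp Require Export all_boot all_order all_algebra.
From mathcomp Require Export boolp classical_sets.

Set Implicit Arguments.
Unset Strict Implicit.
Unset Printing Implicit Defensive.

Import GRing.Theory.
Local Open Scope classical_set_scope.
Local Open Scope ring_scope.

(* [idealr] from ring_quotient is not used for ideals: it requires properness,
   whereas torsion ideals may be the whole ring. *)
Section Ideals.
Variable A : comNzRingType.

Definition is_ideal (I : set A) : Prop :=
  I 0 /\ forall a u v, I u -> I v -> I (a * u + v).

Definition ideal_gen (s : seq A) : set A :=
  [set x | exists c : 'I_(size s) -> A, x = \sum_(i < size s) c i * s`_i].

Definition is_primary_ideal (I : set A) : Prop :=
  [/\ is_ideal I, ~ I 1
    & forall x y, I (x * y) -> I x \/ exists n : nat, (0 < n)%N /\ I (y ^+ n)].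

Definition invertible (a : A) : Prop := exists b, a * b = 1.

(* The library's [irreducible_poly] needs an integral domain of coefficients,
   which GR(p^2,m) is not. *)
Definition irreducible (a : A) : Prop :=
  [/\ a <> 0, ~ invertible a
    & forall b c, a = b * c -> invertible b \/ invertible c].

End Ideals.

(* GR(p^2,m) is unique up to isomorphism, so it is given by its characterization
   as the finite local ring with maximal ideal <p>, characteristic p^2 and
   p^(2m) elements. *)
Record is_galois_ring (p m : nat) (R : finComUnitRingType) : Prop := {
  galois_ring_char : forall n : nat, (n%:R = 0 :> R) <-> (p ^ 2 %| n)%N;
  galois_ring_card : #|R| = (p ^ (2 * m))%N;
  galois_ring_local : forall a : R,
    (a \isn't a GRing.unit) <-> ideal_gen [:: p%:R] a
}.

Record is_reduction (p m : nat) (R : finComUnitRingType) (F : finFieldType)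
    (mu : {rmorphism R -> F}) : Prop := {
  reduction_card : #|F| = (p ^ m)%N;
  reduction_surj : forall b : F, exists a : R, mu a = b;
  reduction_ker : forall a : R, mu a = 0 <-> ideal_gen [:: p%:R] a
}.

Section Torsion.
Variables (p : nat) (R : finComUnitRingType) (F : finFieldType).
Variable mu : {rmorphism R -> F}.

Local Notation "q ^mu" := (map_poly mu q) (at level 2, format "q ^mu").

(* For polynomials q, the degree is (size q).-1; the convention for q = 0 never
   matters, as it is always treated apart. *)
Record standing_assumption (f h beta : {poly R}) (t : nat) : Prop := {
  f_monic : f \is monic;
  f_regular : GRing.lreg f;
  f_primary : is_primary_ideal (ideal_gen [:: f]);
  f_nonunit : ~ invertible f;
  f_form : f = h ^+ t + p%:R * beta;
  t_gt0 : (0 < t)%N;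
  h_monic : h \is monic;
  h_irreducible : irreducible h;
  h_basic : irreducible_poly h^mu;
  beta_deg : beta = 0 \/ ((size beta).-1 < t * (size h).-1)%N
}.

Variable f : {poly R}.

(* {poly %/ f} is the quotient by <f> for monic f of positive degree (its
   elements are the remainders modulo f), which the standing assumption gives
   for both f and its reduction. *)
Definition muq (v : {poly %/ f}) : {poly %/ f^mu} :=
  in_qpoly f^mu (map_poly mu (v : {poly R})).

Definition Tor (i : nat) (C : set {poly %/ f}) : set {poly %/ f^mu} :=
  [set muq v | v in [set v | C (p%:R ^+ i * v)]].

(* The exponent exists and is unique under the standing assumption. The default
   value t.+1 is out of range, so tordeg h t i C <= t forces its existence. *)
Definition tordeg (h : {poly R}) (t i : nat) (C : set {poly %/ f}) : nat :=
  xget t.+1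
    [set T : nat | (T <= t)%N /\
       Tor i C = ideal_gen [:: in_qpoly f^mu (h^mu ^+ T)]].

End Torsion.

(* Main.v *)
Require Import Defs.
From mathcomp Require Import ring.

Set Implicit Arguments.
Unset Strict Implicit.
Unset Printing Implicit Defensive.

Import GRing.Theory.
Local Open Scope classical_set_scope.
Local Open Scope ring_scope.

(** Everything is computed on representatives in [R[x]].  The ideals at hand
    are generated by [g = h^k + p e] and [p w], where [e] is [0] or
    [h^l delta] and [w] is [0] or [h^n]; in [R[x]] they consist of the
    combinations [a g + b p w + c h^t].

    Reducing such a combination modulo [p] leaves a multiple of [h^k], as
    [k <= t], and [g] itself reduces to [h^k]; hence [T_0 = k].

    For [T_1], let [p v = a g + b p w + c h^t].  Modulo [p] the right-hand side
    vanishes, so [a = - c h^(t-k)] modulo [p], say [a = - c h^(t-k) + p d].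
    Substituting, the terms [c h^t] cancel and [p^2 = 0] leaves
    [p v = p (d h^k - c h^(t-k) e + b w)].  The annihilator of [p] is the kernel
    of the reduction, so [v] reduces into the ideal generated by the reductions
    of [h^k], [h^(t-k) e] and [w]; conversely [p] times each of these three lies
    in the ideal, the second because [h^(t-k) g - h^t = p h^(t-k) e].
    This is [tordeg1E].

    It remains to find the generator of this ideal of [F[x]].  As [delta] is
    outside [<p, h>], its reduction is coprime to that of [h], and a Bezout
    relation shows that [h^(t-k+l) delta] may be replaced by [h^(t-k+l)] in the
    presence of [h^k].  The ideal is then generated by powers of the reduction
    of [h], hence by the one with least exponent. *)

(** * Ideals and representatives in quotients of polynomial rings *)

Section Ideals.
Variable A : comNzRingType.

Lemma ideal_gen1P (x y : A) : ideal_gen [:: x] y <-> exists c, y = c * x.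
Proof.
split=> [[c ->]|[c ->]]; first by exists (c ord0); rewrite big_ord1.
by exists (fun=> c); rewrite big_ord1.
Qed.

Lemma ideal_gen2P (x1 x2 y : A) :
  ideal_gen [:: x1; x2] y <-> exists a b, y = a * x1 + b * x2.
Proof.
split=> [[c ->]|[a [b ->]]].
  by exists (c ord0), (c (lift ord0 ord0)); rewrite big_ord_recl big_ord1.
by exists (fun i => if i == ord0 then a else b); rewrite big_ord_recl big_ord1.
Qed.

Lemma ideal_gen_rcons0 (x : A) : ideal_gen [:: x] = ideal_gen [:: x; 0].
Proof.
apply/seteqP; split=> y.
  by move=> /ideal_gen1P[c ->]; apply/ideal_gen2P; exists c, 0; rewrite mulr0 addr0.
by move=> /ideal_gen2P[a [b ->]]; apply/ideal_gen1P; exists a; rewrite mulr0 addr0.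
Qed.

Lemma idealM (I : set A) a u : is_ideal I -> I u -> I (a * u).
Proof. by move=> [I0 IZ] Iu; rewrite -[a * u]addr0; apply: IZ. Qed.

End Ideals.

Section Quotient.
Variables (A : comNzRingType) (f : {poly A}).
Hypotheses (f_monic : f \is monic) (f_gt1 : (1 < size f)%N).

Lemma mk_monicE : mk_monic f = f.
Proof. by rewrite /mk_monic f_gt1 f_monic. Qed.

Lemma in_qpolyK (v : {poly %/ f}) : in_qpoly f v = v.
Proof. by apply: val_inj; apply: in_qpoly_small; apply: size_mk_monic. Qed.

Lemma in_qpolyP (x y : {poly A}) :
  in_qpoly f x = in_qpoly f y <-> exists c, x = y + c * f.
Proof.
split=> [/(congr1 val)|[c ->]]; last first.
  apply: val_inj => /=; rewrite mk_monicE Pdiv.RingMonic.rmodpD //.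
  by rewrite Pdiv.RingMonic.rmodp_mull // addr0.
rewrite /= mk_monicE => eq_mod.
rewrite (Pdiv.RingMonic.rdivp_eq f_monic x) eq_mod.
rewrite [in X in exists _, _ = X + _](Pdiv.RingMonic.rdivp_eq f_monic y).
exists (Pdiv.CommonRing.rdivp x f - Pdiv.CommonRing.rdivp y f).
by rewrite mulrBl; ring.
Qed.

End Quotient.

(** * Reduction modulo [p] of polynomials *)

Section Torsion.
Variables (p : nat) (R : finComUnitRingType) (F : finFieldType).
Variable mu : {rmorphism R -> F}.
Local Notation "q ^mu" := (map_poly mu q) (at level 2, format "q ^mu").

Hypothesis mu_surj : forall b : F, exists a : R, mu a = b.
Hypothesis mu_ker : forall a : R, mu a = 0 -> exists c, a = p%:R * c.
Hypothesis mu_ann : forall a : R, p%:R * a = 0 -> mu a = 0.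
Hypothesis mu_p : mu p%:R = 0.
Hypothesis p_sqr : p%:R * p%:R = 0 :> R.

Lemma map_poly_surj (q : {poly F}) : exists r : {poly R}, r^mu = q.
Proof.
have [g gE] := choice mu_surj.
exists (\poly_(i < size q) g q`_i); apply/polyP=> i.
rewrite coef_map coef_poly; case: ltnP => [_|le_qi]; first exact: gE.
by rewrite nth_default ?raddf0.
Qed.

Lemma map_poly_ker (q : {poly R}) : q^mu = 0 -> exists r, q = p%:R * r.
Proof.
move=> q0.
have /choice[g gE] i : exists c, q`_i = p%:R * c.
  by apply: mu_ker; rewrite -coef_map q0 coef0.
exists (\poly_(i < size q) g i); apply/polyP=> i.
rewrite -polyC_natr coefCM coef_poly; case: ltnP => [_|le_qi]; first exact: gE.
by rewrite mulr0 nth_default.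
Qed.

Lemma map_poly_eq (q r : {poly R}) : q^mu = r^mu -> exists s, q = r + p%:R * s.
Proof.
move=> eq_qr; have [|s sE] := @map_poly_ker (q - r).
  by rewrite rmorphB /= eq_qr subrr.
by exists s; rewrite -sE addrC subrK.
Qed.

Lemma map_poly_ann (q r : {poly R}) : p%:R * q = p%:R * r -> q^mu = r^mu.
Proof.
move=> eq_pqr; apply/eqP; rewrite -subr_eq0 -rmorphB; apply/eqP/polyP=> i.
rewrite coef_map coef0; apply: mu_ann.
by rewrite -coefCM polyC_natr mulrBr eq_pqr subrr coef0.
Qed.

Lemma map_poly_p : (p%:R : {poly R})^mu = 0.
Proof. by rewrite -polyC_natr map_polyC /= mu_p. Qed.

Lemma poly_p_sqr : p%:R * p%:R = 0 :> {poly R}.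
Proof. by rewrite -polyC_natr -polyCM p_sqr. Qed.

(** * Torsion ideals and torsional degrees *)

Variables (h : {poly R}) (t : nat).
Hypotheses (h_monic : h \is monic) (h_gt1 : (1 < size h^mu)%N).
Hypothesis t_gt0 : (0 < t)%N.

Local Notation f := (h ^+ t).
Local Notation cls := (in_qpoly f).

Lemma f_monic_pow : f \is monic.
Proof. exact: monic_exp. Qed.

Lemma fmu_monic : f^mu \is monic.
Proof. exact: monic_map f_monic_pow. Qed.

Lemma fmu_gt1 : (1 < size f^mu)%N.
Proof.
have: (0 < (size f^mu).-1)%N.
  by rewrite rmorphXn /= size_exp muln_gt0 t_gt0 andbT; case: size h_gt1 => [|[]].
by case: size => [|[]].
Qed.

Lemma f_gt1 : (1 < size f)%N.
Proof.
rewrite -(@size_map_poly_id0 _ _ mu f) ?fmu_gt1 //.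
by rewrite (monicP f_monic_pow) rmorph1 oner_neq0.
Qed.

Lemma muq_in_qpoly (v : {poly R}) :
  muq mu (cls v) = in_qpoly f^mu v^mu.
Proof.
rewrite /muq; apply/(in_qpolyP fmu_monic fmu_gt1).
have /(in_qpolyP f_monic_pow f_gt1)[c {1}->] : cls (cls v) = cls v.
  exact: in_qpolyK.
by exists c^mu; rewrite rmorphD rmorphM.
Qed.

(** A torsional degree exists and is determined by two facts about
    representatives: all torsion elements reduce to multiples of [h^T], and
    some torsion element reduces to [h^T] itself.  The second fact is about a
    single well-chosen element because membership of [p^i v] in [C] need not
    depend only on the reduction of [v].  Uniqueness holds because [h^T] divides
    the modulus [h^t] for [T <= t]. *)
Lemma tordegP (C : set {poly %/ f}) (i T : nat) :
    is_ideal C -> (T <= t)%N ->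
    (forall v, C (cls (p%:R ^+ i * v)) -> h^mu ^+ T %| v^mu) ->
    (exists2 v, C (cls (p%:R ^+ i * v)) & v^mu = h^mu ^+ T) ->
  tordeg p mu h t i C = T.
Proof.
move=> C_ideal le_Tt dvdT [v0 Cv0 v0E].
have clsP j (v : {poly R}) : cls (p%:R ^+ j * v) = p%:R ^+ j * cls v.
  by rewrite rmorphM rmorphXn rmorph_nat.
have fmuE : f^mu = h^mu ^+ t by rewrite rmorphXn.
apply: xget_unique => [|T' [le_T't eqT']].
  split=> //; apply/seteqP; split=> y.
    case=> v /= Cv <-; apply/ideal_gen1P.
    have /dvdpP[c cE] : h^mu ^+ T %| (v : {poly R})^mu.
      by apply: dvdT; rewrite clsP in_qpolyK.
    by exists (in_qpoly _ c); rewrite /muq cE rmorphM.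
  case/ideal_gen1P=> c ->; have [c' c'E] := map_poly_surj c.
  exists (cls (c' * v0)).
    by rewrite /= -clsP mulrCA rmorphM; apply: idealM.
  by rewrite muq_in_qpoly rmorphM /= c'E v0E rmorphM /= in_qpolyK.
have mult_dvd j (v : {poly F}) : (j <= t)%N ->
    ideal_gen [:: in_qpoly f^mu (h^mu ^+ j)] (in_qpoly f^mu v) -> h^mu ^+ j %| v.
  move=> le_jt /ideal_gen1P[c]; rewrite -[c]in_qpolyK -rmorphM.
  case/(in_qpolyP fmu_monic fmu_gt1)=> d ->.
  apply: dvdp_add; apply: dvdp_mull; first exact: dvdpp.
  by rewrite fmuE dvdp_exp2l.
apply/eqP; rewrite eqn_leq -!(dvdp_Pexp2l _ _ h_gt1); apply/andP; split.
  apply: mult_dvd => //; rewrite -eqT'; exists (cls v0).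
    by rewrite /= -clsP.
  by rewrite muq_in_qpoly v0E.
have : Tor p i C (in_qpoly f^mu (h^mu ^+ T')).
  by rewrite eqT'; apply/ideal_gen1P; exists 1; rewrite mul1r.
case=> v /= Cv vE.
suff: ideal_gen [:: in_qpoly f^mu (h^mu ^+ T)] (in_qpoly f^mu (h^mu ^+ T')).
  exact: mult_dvd.
have /dvdpP[c cE] : h^mu ^+ T %| (v : {poly R})^mu.
  by apply: dvdT; rewrite clsP in_qpolyK.
by apply/ideal_gen1P; exists (in_qpoly _ c); rewrite -vE /muq cE rmorphM.
Qed.

Section TwoGenerators.
Variables (k : nat) (e w : {poly R}) (C : set {poly %/ f}).
Hypotheses (le_kt : (k <= t)%N) (C_ideal : is_ideal C).
Local Notation g := (h ^+ k + p%:R * e).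
Hypothesis C_gen : C = ideal_gen [:: cls g; cls (p%:R * w)].

Lemma two_generatorsP (x : {poly R}) :
  C (cls x) <-> exists a b c, x = a * g + b * (p%:R * w) + c * f.
Proof.
rewrite C_gen; split=> [/ideal_gen2P[a [b]]|[a [b [c xE]]]].
  rewrite -[a]in_qpolyK -[b]in_qpolyK -!rmorphM -rmorphD.
  case/(in_qpolyP f_monic_pow f_gt1)=> c ->.
  by exists (a : {poly R}), (b : {poly R}), c.
apply/ideal_gen2P; exists (cls a), (cls b); rewrite -!rmorphM -rmorphD.
by apply/(in_qpolyP f_monic_pow f_gt1); exists c.
Qed.

Lemma tordeg0E : tordeg p mu h t 0 C = k.
Proof.
have gmu : g^mu = h^mu ^+ k.
  by rewrite rmorphD rmorphXn rmorphM /= map_poly_p mul0r addr0.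
apply: tordegP => // [v|].
  rewrite expr0 mul1r => /two_generatorsP[a [b [c ->]]].
  rewrite 2!rmorphD !rmorphM /= gmu map_poly_p mul0r mulr0 addr0 rmorphXn /=.
  by rewrite dvdp_add ?dvdp_mull ?dvdp_exp2l.
exists g => //; rewrite expr0 mul1r; apply/two_generatorsP.
by exists 1, 0, 0; rewrite mul1r !mul0r !addr0.
Qed.

(** The hypotheses say that [h^T] generates the ideal spanned by the reductions
    of [h^k], [h^(t-k) e] and [w]. *)
Lemma tordeg1E (T : nat) : (T <= k)%N ->
    h^mu ^+ T %| h^mu ^+ (t - k) * e^mu -> h^mu ^+ T %| w^mu ->
    (exists a b c : {poly F},
       h^mu ^+ T = a * h^mu ^+ k + b * (h^mu ^+ (t - k) * e^mu) + c * w^mu) ->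
  tordeg p mu h t 1 C = T.
Proof.
move=> le_Tk dvd_e dvd_w [a [b [c TE]]].
have hmu_neq0 : h^mu != 0 by rewrite -size_poly_gt0 ltnW.
have fE : f = h ^+ (t - k) * h ^+ k by rewrite -exprD subnK.
apply: tordegP => // [|v|]; first exact: leq_trans le_kt.
  rewrite expr1 => /two_generatorsP[a' [b' [c' vE]]].
  (* modulo p, the relation reads (a' + c' h^(t-k)) h^k = 0 *)
  have /map_poly_eq[d aE] : a'^mu = (- (c' * h ^+ (t - k)))^mu.
    apply/eqP; rewrite rmorphN /= -addr_eq0.
    have /eqP := congr1 (map_poly mu) vE; rewrite fE.
    rewrite !(rmorphD, rmorphM, rmorphXn) /= map_poly_p !mul0r mulr0 !addr0.
    rewrite mulrA -mulrDl eq_sym mulf_eq0 expf_eq0 (negPf hmu_neq0) andbF.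
    by rewrite orbF.
  have : p%:R * v = p%:R * (d * h ^+ k - c' * (h ^+ (t - k) * e) + b' * w).
    rewrite vE aE fE mulrDr !mulrDl mulrDr !mulNr.
    have -> : p%:R * d * (p%:R * e) = 0 by rewrite mulrACA poly_p_sqr mul0r.
    ring.
  move=> /map_poly_ann ->; rewrite !(rmorphB, rmorphD, rmorphM, rmorphXn) /=.
  by rewrite dvdp_add ?dvdp_sub ?(dvdp_mull _ dvd_e) ?dvdp_mull ?dvdp_exp2l.
have [a' aE] := map_poly_surj a; have [b' bE] := map_poly_surj b.
have [c' cE] := map_poly_surj c.
exists (a' * h ^+ k + b' * (h ^+ (t - k) * e) + c' * w); last first.
  by rewrite !(rmorphD, rmorphM, rmorphXn) /= aE bE cE TE.
rewrite expr1; apply/two_generatorsP.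
exists (p%:R * a' + b' * h ^+ (t - k)), c', (- b').
rewrite [_ * (h ^+ k + _)]mulrDl [p%:R * a' * (h ^+ k + _)]mulrDr.
have -> : p%:R * a' * (p%:R * e) = 0 by rewrite mulrACA poly_p_sqr mul0r.
rewrite fE; ring.
Qed.

End TwoGenerators.

(** * Coprimality of [delta] and [h] modulo [p] *)

Lemma coprimep_reduction (delta : {poly R}) : irreducible_poly h^mu ->
  ~ ideal_gen [:: p%:R; h] delta -> coprimep h^mu delta^mu.
Proof.
move=> h_irr delta_notin; rewrite irreducible_poly_coprime //.
apply/negP=> /dvdpP[q qE]; apply: delta_notin; have [c cE] := map_poly_surj q.
have /map_poly_eq[s ->] : delta^mu = (c * h)^mu by rewrite rmorphM /= cE.
by apply/ideal_gen2P; exists s, c; rewrite addrC mulrC.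
Qed.

End Torsion.

(** Modulo [x^k] a polynomial [d] coprime to [x] is invertible, so [x^j] and
    [x^j d] generate the same ideal. *)
Lemma coprimep_exp_comb (F : fieldType) (x d : {poly F}) (j k : nat) :
  coprimep x d -> exists a b, x ^+ j = a * x ^+ k + b * (x ^+ j * d).
Proof.
move=> /(coprimep_expl k)/Bezout_eq1_coprimepP[[a b] /= abE].
exists (x ^+ j * a), b.
by rewrite -mulrA [b * _]mulrCA -mulrDr abE mulr1.
Qed.

(** * The four families of ideals *)

Lemma minn_ind (P : nat -> Prop) a b : P a -> P b -> P (minn a b).
Proof. by rewrite /minn; case: ifP. Qed.

Theorem lemma4p3 (p m : nat) (R : finComUnitRingType) (F : finFieldType)
    (mu : {rmorphism R -> F}) (f h beta : {poly R}) (t : nat)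
    (p_prime : prime p) (m_ge1 : (1 <= m)%N)
    (R_GR : is_galois_ring p m R) (mu_red : is_reduction p m mu)
    (f_std : standing_assumption p mu f h beta t)
    (beta0 : beta = 0)
    (C : set {poly %/ f}) (C_ideal : is_ideal C)
    (k l n : nat) (k_lt_t : (k < t)%N) (l_lt_t : (l < t)%N) (n_lt_t : (n < t)%N)
    (n_lt_k : (n < k)%N)
    (delta : {poly R})
    (delta_notin : ~ ideal_gen [:: p%:R; h] delta)
    (delta_deg : ((size delta).-1 < (k - l) * (size h).-1)%N) :
  let T i := tordeg p mu h t i C in
  let cls := in_qpoly f in
  [/\ C = ideal_gen [:: cls (h ^+ k)] ->
        T 0%N = k /\ T 1%N = k,
      C = ideal_gen [:: cls (h ^+ k + p%:R * h ^+ l * delta)] ->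
        T 0%N = k /\ T 1%N = minn k (t - k + l),
      C = ideal_gen [:: cls (h ^+ k); cls (p%:R * h ^+ n)] ->
        T 0%N = k /\ T 1%N = minn k n
    & C = ideal_gen [:: cls (h ^+ k + p%:R * h ^+ l * delta);
                        cls (p%:R * h ^+ n)] ->
        T 0%N = k /\ T 1%N = minn k (minn (t - k + l) n)].
Proof.
case: f_std => _ _ _ _ f_form t_gt0 h_monic _ h_basic _.
move: f_form; rewrite beta0 mulr0 addr0 => fE; subst f.
case: R_GR => R_char _ R_local; case: mu_red => _ mu_surj mu_kerP.
have mu_ker a : mu a = 0 -> exists c, a = p%:R * c.
  by move=> /mu_kerP/ideal_gen1P[c ->]; exists c; rewrite mulrC.
have mu_p : mu p%:R = 0 by apply/mu_kerP/ideal_gen1P; exists 1; rewrite mul1r.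
have p_sqr : p%:R * p%:R = 0 :> R by rewrite -natrM; apply/R_char.
have mu_ann a : p%:R * a = 0 -> mu a = 0.
  move=> pa0; apply/mu_kerP/R_local/negP => a_unit.
  have /R_char : p%:R = 0 :> R by apply: (mulIr a_unit); rewrite mul0r.
  rewrite -{2}(expn1 p) dvdn_Pexp2l //; exact: prime_gt1.
have h_gt1 := h_basic.1.
have cop := coprimep_reduction mu_surj mu_ker h_basic delta_notin.
have deg0 := tordeg0E mu_surj mu_p h_monic h_gt1 t_gt0 (ltnW k_lt_t) C_ideal.
have deg1 := tordeg1E mu_surj mu_ker mu_ann mu_p p_sqr h_monic h_gt1 t_gt0
  (ltnW k_lt_t) C_ideal.
(* an absent perturbation or second generator is the case e = 0 or w = 0 *)
have no_e : h ^+ k = h ^+ k + p%:R * 0 by rewrite mulr0 addr0.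
have no_w x : ideal_gen [:: x] = ideal_gen [:: x; in_qpoly (h ^+ t) (p%:R * 0)].
  by rewrite mulr0 rmorph0 ideal_gen_rcons0.
have eE : map_poly mu h ^+ (t - k) * map_poly mu (h ^+ l * delta)
    = map_poly mu h ^+ (t - k + l) * map_poly mu delta.
  by rewrite rmorphM rmorphXn /= mulrA exprD.
have [a [b abE]] := coprimep_exp_comb (t - k + l) k cop.
move=> T cls; rewrite {}/T {}/cls; split.
- rewrite no_w {1}no_e => CE; split; first exact: deg0 CE.
  apply: (deg1 _ _ CE); rewrite ?rmorph0 ?mulr0 ?dvdp0 //.
  by exists 1, 0, 0; rewrite mul1r !mul0r !addr0.
- rewrite no_w -mulrA => CE; split; first exact: deg0 CE.
  apply: (deg1 _ _ CE); rewrite ?geq_minl ?rmorph0 ?dvdp0 // eE.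
    by rewrite dvdp_mulr // dvdp_exp2l // geq_minr.
  apply: (@minn_ind (fun T => exists a b c, map_poly mu h ^+ T = _)).
    by exists 1, 0, 0; rewrite mul1r !mul0r !addr0.
  by exists a, b, 0; rewrite mul0r addr0.
- rewrite {1}no_e => CE; split; first exact: deg0 CE.
  apply: (deg1 _ _ CE); rewrite ?geq_minl ?rmorph0 ?mulr0 ?dvdp0 ?rmorphXn //=.
    by rewrite dvdp_exp2l // geq_minr.
  apply: (@minn_ind (fun T => exists a b c, map_poly mu h ^+ T = _)).
    by exists 1, 0, 0; rewrite mul1r !mul0r !addr0.
  by exists 0, 0, 1; rewrite mul1r !mul0r !add0r.
- rewrite -mulrA => CE; split; first exact: deg0 CE.
  apply: (deg1 _ _ CE); rewrite ?geq_minl // ?eE ?rmorphXn /=.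
  + by rewrite dvdp_mulr // dvdp_exp2l // !geq_min leqnn orbT.
  + by rewrite dvdp_exp2l // !geq_min leqnn !orbT.
  apply: (@minn_ind (fun T => exists a b c, map_poly mu h ^+ T = _)).
    by exists 1, 0, 0; rewrite mul1r !mul0r !addr0.
  apply: (@minn_ind (fun T => exists a b c, map_poly mu h ^+ T = _)).
    by exists a, b, 0; rewrite mul0r addr0.
  by exists 0, 0, 1; rewrite mul1r !mul0r !add0r.
Qed.
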